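(* Every semi-Riemannian manifold $(M,g)$ of dimension $n\ge 3$ that is a $P$-space by Venzi satisfies $$W\cdot W=Q\left(S-\tfrac{\kappa}{n}g,\;W\right).$$
   Context: $(M,g)$ is a connected smooth semi-Riemannian manifold of dimension $n\ge 3$; $R$ is the $(0,4)$ Riemann curvature tensor, with the sign convention that the Ricci tensor $S(X_2,X_3)$ is the $g$-trace of $R(X_1,X_2,X_3,X_4)$ over $X_1,X_4$; $\kappa$ is the scalar curvature. Projective curvature tensor: $P(X_1,X_2,X_3,X_4)=R(X_1,X_2,X_3,X_4)-\frac{1}{n-1}\left[S(X_2,X_3)g(X_1,X_4)-S(X_1,X_3)g(X_2,X_4)\right]$. Concircular curvature tensor: $W(X_1,X_2,X_3,X_4)=R(X_1,X_2,X_3,X_4)-\frac{\kappa}{n(n-1)}\left[g(X_1,X_4)g(X_2,X_3)-g(X_1,X_3)g(X_2,X_4)\right]$. For a $(0,4)$-tensor $D$, let $\mathcal L(M)$ be the vector space of all 1-forms $\Theta$ on $M$ satisfying $$\Theta(X_1)D(X_2,X_3,X_4,X_5)+\Theta(X_2)D(X_3,X_1,X_4,X_5)+\Theta(X_3)D(X_1,X_2,X_4,X_5)=0$$ for all vector fields $X_1,\dots,X_5$. $M$ is called a $D$-space by Venzi if $\dim\mathcal L(M)\ge1$. For a $(0,4)$-tensor $D$, let $\mathcal D$ be the $(1,3)$-tensor with $g(\mathcal D(X,Y)X_1,X_2)=D(X,Y,X_1,X_2)$. For a $(0,k)$-tensor $H$, $(D\cdot H)(X_1,\dots,X_k,X,Y)=-\sum_{i=1}^kH(X_1,\dots,\mathcal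 D(X,Y)X_i,\dots,X_k)$. For a symmetric $(0,2)$-tensor $A$, $(X\wedge_AY)Z=A(Y,Z)X-A(X,Z)Y$ and $Q(A,H)(X_1,\dots,X_k,X,Y)=-\sum_{i=1}^k H(X_1,\dots,(X\wedge_AY)X_i,\dots,X_k)$.
   Formalization: ''P-space by Venzi'' is taken to mean that at every point some 1-form in L(M) is nonzero there; with only dim L(M) ≥ 1 the claim fails, since a bump form supported where P = 0 always lies in L(M). *)

(* Defs.v *)
From HB Require Import structures.
From mathcomp Require Import all_boot all_order all_algebra.
From mathcomp Require Import all_classical all_reals all_analysis.

Set Implicit Arguments.
Unset Strict Implicit.
Unset Printing Implicit Defensive.
Import Order.TTheory GRing.Theory Num.Theory.
Import numFieldNormedType.Exports.
Local Open Scope classical_set_scope.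
Local Open Scope ring_scope.

(** * Smooth manifolds *)

Fixpoint Ck_on (R : realType) (V W : normedModType R) (U : set V) (k : nat)
    (f : V -> W) : Prop :=
  match k with
  | 0%N => forall x, U x -> {for x, continuous f}
  | k'.+1 => (forall x, U x -> differentiable f x) /\
             (forall v : V, Ck_on U k' ('D_v f))
  end.

Definition smooth_on (R : realType) (V W : normedModType R) (U : set V)
  (f : V -> W) : Prop := forall k, Ck_on U k f.

(* [cmap] and [cinv] are total functions; only the values of [cmap] on [cdom]
   and of [cinv] on [cimg] are meaningful. *)
Record chart (R : realType) (n : nat) (M : topologicalType) := Chart {
  cdom : set M;
  cmap : M -> 'rV[R]_n;
  cinv : 'rV[R]_n -> M;
  cdom_open : open cdom;
  cimg_open : open (cmap @` cdom);
  cmapK : forall p, cdom p -> cinv (cmap p) = p;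
  cmap_continuous : forall p, cdom p -> {for p, continuous cmap};
  cinv_continuous : forall x, (cmap @` cdom) x -> {for x, continuous cinv}
}.

Definition cimg (R : realType) (n : nat) (M : topologicalType)
  (c : chart R n M) : set 'rV[R]_n := cmap c @` cdom c.

Definition transition (R : realType) (n : nat) (M : topologicalType)
  (c c' : chart R n M) : 'rV[R]_n -> 'rV[R]_n := cmap c' \o cinv c.

Record manifold (R : realType) (n : nat) := Manifold {
  points :> topologicalType;
  atlas : set (chart R n points);
  atlas_cover : forall p : points, exists2 c, atlas c & cdom c p;
  atlas_compatible : forall c c', atlas c -> atlas c' ->
    smooth_on (cmap c @` (cdom c `&` cdom c')) (transition c c');
  manifold_hausdorff : hausdorff_space points;
  manifold_second_countable : @second_countable points
}.

(* A tensor field is given by its components in every chart of the atlas.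
   Tangent vectors in a chart are row vectors, and [v *m 'J f x] is the image
   of [v] under the differential of [f] at [x]. *)

(* In the chart [c], g(u, v) = u *m metric_mx c p *m v^T.  The index is not
   recorded: it is locally constant because the matrices are invertible. *)
Record metric (R : realType) (n : nat) (M : manifold R n) := Metric {
  metric_mx : chart R n M -> M -> 'M[R]_n;
  metric_smooth : forall c, atlas c ->
    smooth_on (cimg c) (metric_mx c \o cinv c);
  metric_sym : forall c p, atlas c -> cdom c p ->
    (metric_mx c p)^T = metric_mx c p;
  metric_nondegenerate : forall c p, atlas c -> cdom c p ->
    metric_mx c p \in unitmx;
  metric_change : forall c c' p, atlas c -> atlas c' ->
    cdom c p -> cdom c' p ->
    let J := 'J (transition c c') (cmap c p) in
    metric_mx c p = J *m metric_mx c' p *m J^T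
}.

(* In the chart [c], Theta(v) = \sum_i v 0 i * form_rv c p 0 i. *)
Record one_form (R : realType) (n : nat) (M : manifold R n) := OneForm {
  form_rv : chart R n M -> M -> 'rV[R]_n;
  form_smooth : forall c, atlas c -> smooth_on (cimg c) (form_rv c \o cinv c);
  form_change : forall c c' p, atlas c -> atlas c' ->
    cdom c p -> cdom c' p ->
    form_rv c p = form_rv c' p *m ('J (transition c c') (cmap c p))^T
}.

(** * Tensor algebra on a tangent space *)

Section TensorAlgebra.
Context {R : realType} {n : nat}.
Local Notation V := 'rV[R]_n.

Definition tensor2 : Type := V -> V -> R.
Definition tensor4 : Type := V -> V -> V -> V -> R.

Definition basis_vector (i : 'I_n) : V := delta_mx 0 i.

Definition inner (g : 'M[R]_n) : tensor2 := fun u v => (u *m g *m v^T) 0 0.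

Definition pairing (theta u : V) : R := \sum_i u 0 i * theta 0 i.

(* trace over the first and last slots *)
Definition ricci (g : 'M[R]_n) (D : tensor4) : tensor2 := fun X2 X3 =>
  \sum_i \sum_j
    invmx g i j * D (basis_vector i) X2 X3 (basis_vector j).

Definition trace2 (g : 'M[R]_n) (A : tensor2) : R :=
  \sum_i \sum_j invmx g i j * A (basis_vector i) (basis_vector j).

Definition scalar_curvature (g : 'M[R]_n) (D : tensor4) : R :=
  trace2 g (ricci g D).

Definition projective (g : 'M[R]_n) (D : tensor4) : tensor4 :=
  fun X1 X2 X3 X4 =>
  D X1 X2 X3 X4 - (n%:R - 1)^-1 *
    (ricci g D X2 X3 * inner g X1 X4 - ricci g D X1 X3 * inner g X2 X4).

Definition concircular (g : 'M[R]_n) (D : tensor4) : tensor4 :=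
  fun X1 X2 X3 X4 =>
  D X1 X2 X3 X4 - scalar_curvature g D / (n%:R * (n%:R - 1)) *
    (inner g X1 X4 * inner g X2 X3 - inner g X1 X3 * inner g X2 X4).

(* the (1,3)-tensor of [D]; see [inner_raise] *)
Definition raise (g : 'M[R]_n) (D : tensor4) : V -> V -> V -> V :=
  fun X Y Z => (\row_j D X Y Z (basis_vector j)) *m invmx g.

Lemma inner_raise (g : 'M[R]_n) (D : tensor4) (X Y X1 X2 : V) :
  g \in unitmx ->
  (forall U, D X Y X1 U = \sum_j U 0 j * D X Y X1 (basis_vector j)) ->
  inner g (raise g D X Y X1) X2 = D X Y X1 X2.
Proof.
move=> gu Dlin; rewrite /inner /raise -mulmxA mulmxA mulmxKV // mxE Dlin.
by apply: eq_bigr => j _; rewrite !mxE mulrC.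
Qed.

Definition wedge (A : tensor2) : V -> V -> V -> V :=
  fun X Y Z => A Y Z *: X - A X Z *: Y.

Definition act (E : V -> V -> V -> V) (H : tensor4) (X1 X2 X3 X4 X Y : V) : R :=
  - (H (E X Y X1) X2 X3 X4 + H X1 (E X Y X2) X3 X4 +
     H X1 X2 (E X Y X3) X4 + H X1 X2 X3 (E X Y X4)).

(* D . H *)
Definition dot (g : 'M[R]_n) (D H : tensor4) := act (raise g D) H.

(* Q(A, H) *)
Definition tachibana (A : tensor2) (H : tensor4) := act (wedge A) H.

End TensorAlgebra.

(** * Curvature *)

Section Curvature.
Context {R : realType} {n : nat}.
Context (G : 'rV[R]_n -> 'M[R]_n).

Definition partial (i : 'I_n) (f : 'rV[R]_n -> R) : 'rV[R]_n -> R :=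
  'D_(basis_vector i) f.

(* Gamma^k_{ij} *)
Definition christoffel (k i j : 'I_n) (x : 'rV[R]_n) : R :=
  2^-1 * \sum_l invmx (G x) k l *
    (partial i (fun y => G y j l) x + partial j (fun y => G y i l) x
     - partial l (fun y => G y i j) x).

(* R(d_i, d_j) d_k = \sum_l riemann_up i j k l d_l, where
   R(X, Y) = [nabla_X, nabla_Y] - nabla_[X, Y] *)
Definition riemann_up (i j k l : 'I_n) (x : 'rV[R]_n) : R :=
  partial i (christoffel l j k) x - partial j (christoffel l i k) x
  + \sum_m (christoffel l i m x * christoffel m j k x
            - christoffel l j m x * christoffel m i k x).

(* g(R(d_i, d_j) d_k, d_l) *)
Definition riemann_low (i j k l : 'I_n) (x : 'rV[R]_n) : R :=
  \sum_m riemann_up i j k m x * G x m l.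

End Curvature.

Section Fields.
Context {R : realType} {n : nat} {M : manifold R n}.

Definition riemann (g : metric M) (c : chart R n M) (p : M) : tensor4 :=
  fun X1 X2 X3 X4 =>
  \sum_i \sum_j \sum_k \sum_l X1 0 i * X2 0 j * X3 0 k * X4 0 l *
    riemann_low (metric_mx g c \o cinv c) i j k l (cmap c p).

Definition ricci_tensor (g : metric M) c p : tensor2 :=
  ricci (metric_mx g c p) (riemann g c p).

Definition kappa (g : metric M) c p : R :=
  scalar_curvature (metric_mx g c p) (riemann g c p).

Definition projective_tensor (g : metric M) c p : tensor4 :=
  projective (metric_mx g c p) (riemann g c p).

Definition concircular_tensor (g : metric M) c p : tensor4 :=
  concircular (metric_mx g c p) (riemann g c p).

(* the space L(M) of [D] *)
Definition venzi_forms (D : chart R n M -> M -> tensor4) : set (one_form M) :=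
  [set Theta | forall c p, atlas c -> cdom c p ->
    forall X1 X2 X3 X4 X5 : 'rV[R]_n,
      let T := pairing (form_rv Theta c p) in
      T X1 * D c p X2 X3 X4 X5 + T X2 * D c p X3 X1 X4 X5
      + T X3 * D c p X1 X2 X4 X5 = 0].

(* L(M) is nontrivial at every point.  Requiring a single form that is nonzero
   somewhere would say nothing about [D] away from the support of that form: a
   bump form supported where [D] vanishes always belongs to L(M). *)
Definition venzi_space (D : chart R n M -> M -> tensor4) : Prop :=
  forall p : M, exists2 Theta, venzi_forms D Theta &
    exists c, [/\ atlas c, cdom c p & form_rv Theta c p != 0].

End Fields.

(* Main.v *)
(** At a point, let theta be a nonzero Venzi form, T its metric dual and H its
    kernel.  The Venzi condition says that P vanishes on H x H in its first pair
    of slots, so there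
    R(X, Y, Z, V) = (S(Y, Z) g(X, V) - S(X, Z) g(Y, V)) / (n - 1).
    Antisymmetry of R in its last pair and a trace force
    S = lam g + mu theta (x) theta.  Then R0 := R - lam / (n - 1) G, with G the
    curvature tensor of constant curvature 1, is a curvature tensor vanishing on
    H x H, hence the Kulkarni-Nomizu product of theta (x) theta with a symmetric
    form B; computing its Ricci tensor, which is mu theta (x) theta, gives
    B(T, .) = 0, g(T, T) B = 0 and mu g(T, T) = 0.  Therefore kappa = n lam and
    W = R0, and W(T, ., ., .) = 0.  Both sides of the identity vanish: modulo T, the
    endomorphisms W(X, Y) and X /\_A Y have the form Z |-> theta(Z) c with
    theta(c) = 0, and those annihilate W. *)

Require Import Defs.
From mathcomp Require Import all_boot all_order all_algebra.
From mathcomp Require Import all_classical all_reals all_analysis.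
From mathcomp Require Import ring lra.
Import Order.TTheory GRing.Theory Num.Theory.
Import numFieldNormedType.Exports.
Local Open Scope classical_set_scope.
Local Open Scope ring_scope.

(** * Symmetry of second derivatives *)

Section Schwarz.
Context {R : realType} {V : normedModType R}.
Implicit Types (f : V -> R) (p u v : V).

Lemma is_derive_line f p u (a : R) : derivable f (p + a *: u) u ->
  is_derive a 1 (fun t : R => f (p + t *: u)) ('D_u f (p + a *: u)).
Proof.
move=> df; have E :
    (fun h : R => h^-1 *:
      (((fun t : R => f (p + t *: u)) \o shift a) (h *: 1) - f (p + a *: u))) =
    (fun h : R => h^-1 *:
      ((f \o shift (p + a *: u)) (h *: u) - f (p + a *: u))).
  apply/funext => h /=; congr (_ *: (f _ - _)).
  by rewrite -[h *: 1]/(h * 1) mulr1 scalerDl addrCA.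
by apply: DeriveDef; rewrite /derivable /derive E.
Qed.

Lemma MVT_line f p u (s : R) : 0 < s ->
    (forall a, 0 <= a <= s -> derivable f (p + a *: u) u) ->
  exists2 a, 0 <= a <= s &
    f (p + s *: u) - f p = 'D_u f (p + a *: u) * s.
Proof.
move=> s0 df.
have [||a] := @MVT R (fun t => f (p + t *: u)) (fun t => 'D_u f (p + t *: u))
  0 s s0.
- move=> t; rewrite in_itv /= => /andP[t0 ts].
  by apply: is_derive_line; apply: df; rewrite !ltW.
- apply: derivable_within_continuous => t; rewrite in_itv /= => ts.
  by have [] := is_derive_line _ _ _ _ (df t ts).
- rewrite in_itv /= => /andP[a0 ats]; rewrite scale0r addr0 subr0 => E.
  by exists a => //; rewrite !ltW.
Qed.

(** The mean value theorem is applied twice: along [u] to the increment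
    [F y = f (y + s *: v) - f y], then along [v] to ['D_u f]. *)
Lemma mixed_difference f p u v (s : R) : 0 < s ->
    (forall a b, 0 <= a <= s -> 0 <= b <= s ->
      derivable f (p + a *: u + b *: v) u /\
      derivable ('D_u f) (p + a *: u + b *: v) v) ->
  exists a b, [/\ 0 <= a <= s, 0 <= b <= s &
    f (p + s *: u + s *: v) - f (p + s *: u) - (f (p + s *: v) - f p) =
    'D_v ('D_u f) (p + a *: u + b *: v) * s * s].
Proof.
move=> s0 df.
have s0s : 0 <= s <= s by rewrite lexx ltW.
have z0s : 0 <= (0 : R) <= s by rewrite lexx ltW.
pose F y := f (y + s *: v) - f y.
have dF a : 0 <= a <= s -> is_derive (p + a *: u) u F
    ('D_u f (p + a *: u + s *: v) - 'D_u f (p + a *: u)).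
  move=> ais; apply: is_deriveB; last first.
    apply: derivableP; have [+ _] := df a 0 ais z0s.
    by rewrite scale0r addr0.
  have [d1 _] := df a s ais s0s.
  have E :
    (fun h : R => h^-1 *:
      (((fun y => f (y + s *: v)) \o shift (p + a *: u)) (h *: u)
       - f (p + a *: u + s *: v))) =
    (fun h : R => h^-1 *:
      ((f \o shift (p + a *: u + s *: v)) (h *: u) - f (p + a *: u + s *: v))).
    by apply/funext => h /=; rewrite !addrA.
  by apply: DeriveDef; rewrite /derivable /derive E.
have [a ai /= Ea] : exists2 a, 0 <= a <= s &
    F (p + s *: u) - F p = 'D_u F (p + a *: u) * s.
  by apply: MVT_line => // a ai; have [] := dF a ai.
have [b bi Eb] : exists2 b, 0 <= b <= s &
    'D_u f (p + a *: u + s *: v) - 'D_u f (p + a *: u) =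
    'D_v ('D_u f) (p + a *: u + b *: v) * s.
  by apply: MVT_line => // b bi; have [] := df a b ai bi.
exists a, b; split=> //; rewrite -Eb.
by have [_ <-] := dF a ai; rewrite -Ea.
Qed.

(** If the two values differed by [d > 0], continuity would give a ball around [x] on which each
    mixed derivative stays within [d / 2] of its value at [x]. On a small parallelogram in that
    ball, [mixed_difference] in both orders produces equal values of the two derivatives, so
    [d < d]. *)
Lemma derive_comm (U : set V) f x u v : open U -> U x ->
    (forall y, U y -> [/\ derivable f y u, derivable f y v,
      derivable ('D_u f) y v & derivable ('D_v f) y u]) ->
    {for x, continuous ('D_v ('D_u f))} -> {for x, continuous ('D_u ('D_v f))} ->
  'D_v ('D_u f) x = 'D_u ('D_v f) x.
Proof.
move=> oU Ux df cvu cuv; apply/eqP; rewrite -subr_eq0 -normr_le0 leNgt.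
apply/negP => d0.
set d := `| _ | in d0.
have d2 : 0 < d / 2 by rewrite divr_gt0.
have : nbhs x (U `&` ([set y | `|'D_v ('D_u f) x - 'D_v ('D_u f) y| < d / 2] `&`
    [set y | `|'D_u ('D_v f) x - 'D_u ('D_v f) y| < d / 2])).
  have n1 : nbhs x U by exact: open_nbhs_nbhs.
  have /cvgrPdist_lt /(_ _ d2) n2 := cvu.
  have /cvgrPdist_lt /(_ _ d2) n3 := cuv.
  exact: (filterI n1 (filterI n2 n3)).
case/nbhs_normP => e /= e0 He.
(* With this [s] the whole parallelogram lies in the ball of radius [e]; the [+ 1] keeps the
   denominator positive and the inequality strict. *)
pose s := e / (`|u| + `|v| + 1).
have N0 : 0 < `|u| + `|v| + 1 by rewrite ltr_wpDl // addr_ge0.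
have s0 : 0 < s by rewrite divr_gt0.
have near_x a b : 0 <= a <= s -> 0 <= b <= s -> `|x - (x + a *: u + b *: v)| < e.
  move=> /andP[a0 ats] /andP[b0 bs].
  rewrite -addrA opprD addrA subrr sub0r normrN.
  apply: (le_lt_trans (ler_normD _ _)); rewrite !normrZ !ger0_norm //.
  apply: (@le_lt_trans _ _ (s * (`|u| + `|v|))).
    by rewrite mulrDr lerD // ler_wpM2r.
  have -> : e = s * (`|u| + `|v| + 1) by rewrite /s divfK // gt_eqF.
  by rewrite ltr_pM2l // ltrDl.
have [a [b [ai bi E1]]] : exists a b, [/\ 0 <= a <= s, 0 <= b <= s &
    f (x + s *: u + s *: v) - f (x + s *: u) - (f (x + s *: v) - f x) =
    'D_v ('D_u f) (x + a *: u + b *: v) * s * s].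
  apply: (mixed_difference f x u v s s0) => a b ai bi.
  by have [/df[]] := He _ (near_x a b ai bi).
have [a' [b' [ai' bi' E2]]] : exists a b, [/\ 0 <= a <= s, 0 <= b <= s &
    f (x + s *: v + s *: u) - f (x + s *: v) - (f (x + s *: u) - f x) =
    'D_u ('D_v f) (x + a *: v + b *: u) * s * s].
  apply: (mixed_difference f x v u s s0) => t w ti wi.
  by rewrite addrAC; have [/df[]] := He _ (near_x w t wi ti).
have [_ [h1 _]] := He _ (near_x _ _ ai bi).
have [_ [_ h2]] := He _ (near_x _ _ bi' ai').
(* Both sides are the same mixed difference of [f], divided by [s ^+ 2]. *)
have E : 'D_v ('D_u f) (x + a *: u + b *: v) =
    'D_u ('D_v f) (x + b' *: u + a' *: v).
  apply: (mulIf (lt0r_neq0 s0)); apply: (mulIf (lt0r_neq0 s0)).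
  by rewrite -E1 [x + b' *: u + _]addrAC -E2 [x + s *: v + _]addrAC; ring.
have : d < d; last by rewrite ltxx.
rewrite {2}(splitr d); apply: le_lt_trans (ltrD h1 h2).
rewrite [X in _ <= _ + X]distrC E; apply: le_trans (ler_normD _ _).
by rewrite addrA subrK.

Qed.

End Schwarz.

(** * Symmetries of the Riemann tensor *)

Section DerivableMatrix.
Context {R : realType} {V : normedModType R}.
Variables (x v : V).

Lemma derivable_bigsum I (r : seq I) (P : pred I) (h : I -> V -> R) :
  (forall i, derivable (h i) x v) ->
  derivable (fun y => \sum_(i <- r | P i) h i y) x v.
Proof.
move=> dh; elim: r => [|i r IH].
  by under eq_fun do rewrite big_nil; exact: derivable_cst.
under eq_fun do rewrite big_cons; case: (P i) => //.
exact: derivableD.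
Qed.

Lemma derivable_bigprod I (r : seq I) (P : pred I) (h : I -> V -> R) :
  (forall i, derivable (h i) x v) ->
  derivable (fun y => \prod_(i <- r | P i) h i y) x v.
Proof.
move=> dh; elim: r => [|i r IH].
  by under eq_fun do rewrite big_nil; exact: derivable_cst.
under eq_fun do rewrite big_cons; case: (P i) => //.
exact: derivableM.
Qed.

Lemma derivable_det m (F : V -> 'M[R]_m) :
  (forall i j, derivable (fun y => F y i j) x v) ->
  derivable (fun y => \det (F y)) x v.
Proof.
move=> dF; rewrite /determinant; apply: derivable_bigsum => s.
apply: (@derivableM _ _ (cst _)); first exact: derivable_cst.
exact: derivable_bigprod.
Qed.

(** Near [x] the inverse is the adjugate divided by the determinant, and both are polynomial in the
    entries. *)
Lemma derivable_invmx m (F : V -> 'M[R]_m) i j :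
  (\forall y \near x, F y \in unitmx) ->
  (forall i j, derivable (fun y => F y i j) x v) ->
  derivable (fun y => invmx (F y) i j) x v.
Proof.
move=> Fu dF; apply: (@near_eq_derivable _ _ _
  (fun y => (\det (F y))^-1 * cofactor (F y) j i)).
  by near=> y; have uy : F y \in unitmx by [near: y]; rewrite /invmx uy !mxE.
apply: (@derivableM _ _ (fun y => (\det (F y))^-1)).
  apply: derivableV; last exact: derivable_det.
  by have /nbhs_singleton := Fu; rewrite unitmxE unitfE.
apply: (@derivableM _ _ (cst _)); first exact: derivable_cst.
apply: derivable_det => k l; rewrite [X in derivable X](_ : _ =
  fun y => F y (lift j k) (lift i l)) //.
by apply/funext => y; rewrite !mxE.
Unshelve. all: by end_near.
Qed.

Lemma is_derive_bigsum m (h : 'I_m -> V -> R) (dh : 'I_m -> R) :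
  (forall i, is_derive x v (h i) (dh i)) ->
  is_derive x v (fun y => \sum_i h i y) (\sum_i dh i).
Proof.
move=> H; have -> : (fun y => \sum_i h i y) = \sum_i h i.
  by apply/funext => y; rewrite fct_sumE.
exact: is_derive_sum.
Qed.

End DerivableMatrix.

Section RiemannSymmetries.
Context {R : realType} {n : nat}.
Variables (G : 'rV[R]_n -> 'M[R]_n) (U : set 'rV[R]_n).
Hypotheses (U_open : open U) (G_smooth : smooth_on U G).
Hypothesis G_sym : forall x, U x -> (G x)^T = G x.
Hypothesis G_unit : forall x, U x -> G x \in unitmx.

Let nbhsU x : U x -> \near x, U x.
Proof. by move=> Ux; exact: open_nbhs_nbhs. Qed.

Lemma eq_derive_on (f h : 'rV[R]_n -> R) x v :
  (forall y, U y -> f y = h y) -> U x -> 'D_v f x = 'D_v h x.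
Proof.
move=> fh Ux; apply: near_eq_derive; apply: filterS (nbhsU x Ux) => y.
exact: fh.
Qed.

(** Smoothness is assumed of the matrix-valued [G], while Christoffel symbols differentiate single
    entries; this lemma and the following ones pass from one to the other, up to second order. *)
Lemma derive_entry x v i j : U x ->
  'D_v (fun y => G y i j) x = ('D_v G x) i j.
Proof.
move=> Ux; have [/(_ x Ux) dG _] := G_smooth 1%N.
by rewrite derive_mx ?mxE //; exact: diff_derivable.
Qed.

Lemma derivable_entry x v i j : U x -> derivable (fun y => G y i j) x v.
Proof.
move=> Ux; have [/(_ x Ux) dG _] := G_smooth 1%N.
by apply: (derivable_mxP G x v).1; exact: diff_derivable.
Qed.

Lemma derivable_derive_entry x v w i j : U x ->
  derivable ('D_v (fun y => G y i j)) x w.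
Proof.
move=> Ux; have [_ /(_ v) [/(_ x Ux) dG _]] := G_smooth 2%N.
apply: (@near_eq_derivable _ _ _ (fun y => ('D_v G y) i j)).
  by apply: filterS (nbhsU x Ux) => y Uy; rewrite derive_entry.
by apply: (derivable_mxP ('D_v G) x w).1; exact: diff_derivable.
Qed.

Lemma derive_derive_entry x v w i j : U x ->
  'D_w ('D_v (fun y => G y i j)) x = ('D_w ('D_v G) x) i j.
Proof.
move=> Ux; have [_ /(_ v) [/(_ x Ux) dG _]] := G_smooth 2%N.
rewrite derive_mx; last exact: diff_derivable.
by rewrite mxE; apply: eq_derive_on => // y Uy; rewrite derive_entry.
Qed.

Lemma continuous_derive_derive_entry x v w i j : U x ->
  {for x, continuous ('D_w ('D_v (fun y => G y i j)))}.
Proof.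
move=> Ux; have [_ /(_ v) [_ /(_ w) dG]] := G_smooth 2%N.
have E : 'D_w ('D_v (fun y => G y i j)) x = ('D_w ('D_v G) x) i j.
  exact: derive_derive_entry.
rewrite /prop_for /continuous_at E.
have nE : {near x, (fun y => ('D_w ('D_v G) y) i j) =1
    'D_w ('D_v (fun y => G y i j))}.
  apply: filterS (nbhsU x Ux) => y Uy.
  exact: esym (derive_derive_entry y v w i j Uy).
apply: (cvg_trans (near_eq_cvg nE)).
exact: (@continuous_comp _ _ _ ('D_w ('D_v G)) (fun M : 'M[R]_n => M i j) x
  (dG x Ux) (@coord_continuous _ _ _ i j _)).
Qed.

Lemma derive_entry_comm x v w i j : U x ->
  'D_w ('D_v (fun y => G y i j)) x = 'D_v ('D_w (fun y => G y i j)) x.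
Proof.
move=> Ux; apply: (derive_comm U) => //.
- move=> y Uy; split.
  + exact: derivable_entry.
  + exact: derivable_entry.
  + exact: derivable_derive_entry.
  + exact: derivable_derive_entry.
- exact: continuous_derive_derive_entry.
- exact: continuous_derive_derive_entry.
Qed.

(* g(nabla_i d_j, d_l) *)
Definition christoffel_low (l i j : 'I_n) (x : 'rV[R]_n) : R :=
  2^-1 * (partial i (fun y => G y j l) x + partial j (fun y => G y i l) x
          - partial l (fun y => G y i j) x).

Local Notation Gam := (christoffel G).
Local Notation gam := christoffel_low.

Let G_entry_sym x i j : U x -> G x i j = G x j i.
Proof. by move=> Ux; rewrite -[in LHS](G_sym x Ux) mxE. Qed.

Let dG_sym x l i j : U x ->
  partial l (fun y => G y i j) x = partial l (fun y => G y j i) x.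
Proof. by move=> Ux; apply: eq_derive_on => // y; exact: G_entry_sym. Qed.

Lemma christoffel_low_sym x l i j : U x -> gam l i j x = gam l j i x.
Proof. by move=> Ux; rewrite /gam (dG_sym x l i j Ux) [X in X - _]addrC. Qed.

(** This is nabla g = 0 in coordinates: by the symmetry of g, the other four partial derivatives
    cancel in pairs. *)
Lemma metric_compatible x i j l : U x ->
  partial i (fun y => G y j l) x = gam l i j x + gam j i l x.
Proof.
move=> Ux; rewrite /gam (dG_sym x l i j Ux) (dG_sym x j i l Ux).
by rewrite (dG_sym x i l j Ux); field.
Qed.

Lemma christoffelE x k i j :
  Gam k i j x = \sum_l invmx (G x) k l * gam l i j x.
Proof.
by rewrite /christoffel mulr_sumr; apply: eq_bigr => l _; rewrite mulrCA.
Qed.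

Lemma christoffel_sym x k i j : U x -> Gam k i j x = Gam k j i x.
Proof.
move=> Ux; rewrite !christoffelE; apply: eq_bigr => l _.
by rewrite christoffel_low_sym.
Qed.

Lemma christoffel_lowering x l i j : U x ->
  \sum_k Gam k i j x * G x k l = gam l i j x.
Proof.
move=> Ux; pose w : 'cV[R]_n := \col_m gam m i j x.
transitivity (((G x)^T *m (invmx (G x) *m w)) l 0).
  rewrite mxE; apply: eq_bigr => k _; rewrite mxE mulrC christoffelE mxE.
  by congr (_ * _); apply: eq_bigr => m _; rewrite mxE.
by rewrite G_sym // mulKVmx ?G_unit // mxE.
Qed.

Lemma derivable_christoffel_low x v l i j : U x -> derivable (gam l i j) x v.
Proof.
move=> Ux; apply: (@derivableM _ _ (cst _)); first exact: derivable_cst.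
apply: derivableB; last exact: derivable_derive_entry.
by apply: derivableD; exact: derivable_derive_entry.
Qed.

Lemma derivable_christoffel x v k i j : U x -> derivable (Gam k i j) x v.
Proof.
move=> Ux; rewrite (_ : Gam k i j = fun y => \sum_l invmx (G y) k l * gam l i j y).
  apply: derivable_bigsum => l.
  apply: (@derivableM _ _ (fun y => invmx (G y) k l)).
    apply: derivable_invmx => [|? ?]; last exact: derivable_entry.
    by apply: filterS (nbhsU x Ux) => y; exact: G_unit.
  exact: derivable_christoffel_low.
by apply/funext => y; exact: christoffelE.
Qed.

(** The product rule is applied to [christoffel_lowering], with [metric_compatible] for the
    derivative of [G]; no derivative of the inverse matrix has to be computed. *)
Lemma partial_christoffel_lowering x i l j k : U x ->
  \sum_m partial i (Gam m j k) x * G x m l =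
  partial i (gam l j k) x -
  \sum_m Gam m j k x * (gam l i m x + gam m i l x).
Proof.
move=> Ux; apply/eqP; rewrite eq_sym subr_eq -big_split /=; apply/eqP.
transitivity (partial i (fun y => \sum_m Gam m j k y * G y m l) x).
  by apply: eq_derive_on => // y Uy; rewrite christoffel_lowering.
have H : is_derive x (basis_vector i) (fun y => \sum_m Gam m j k y * G y m l)
  (\sum_m (partial i (Gam m j k) x * G x m l +
           Gam m j k x * (gam l i m x + gam m i l x))).
  apply: is_derive_bigsum => m.
  rewrite -metric_compatible //.
  have d1 := derivableP (derivable_christoffel x (basis_vector i) m j k Ux).
  have d2 := derivableP (derivable_entry x (basis_vector i) m l Ux).
  apply: is_derive_eq (is_deriveM d1 d2) _.
  by rewrite addrC [X in X + _]mulrC.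
by have [_ <-] := H.
Qed.

(** Lowering the last index produces four quadratic sums, two of which cancel the quadratic part of
    [riemann_up]. The remaining form makes the three symmetries accessible. *)
Lemma riemann_lowE x i j k l : U x -> riemann_low G i j k l x =
  partial i (gam l j k) x - partial j (gam l i k) x
  - \sum_m Gam m j k x * gam m i l x + \sum_m Gam m i k x * gam m j l x.
Proof.
move=> Ux; rewrite /riemann_low /riemann_up.
under eq_bigr do rewrite mulrDl mulrBl.
rewrite big_split sumrB.
have E :
    \sum_m (\sum_p (Gam m i p x * Gam p j k x - Gam m j p x * Gam p i k x))
      * G x m l =
    \sum_p Gam p j k x * gam l i p x - \sum_p Gam p i k x * gam l j p x.
  under eq_bigr do rewrite mulr_suml.
  rewrite exchange_big -sumrB /=; apply: eq_bigr => p _.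
  rewrite -!christoffel_lowering // !mulr_sumr -sumrB.
  by apply: eq_bigr => m _; ring.
have D a b : \sum_m Gam m b k x * (gam l a m x + gam m a l x) =
    \sum_m Gam m b k x * gam l a m x + \sum_m Gam m b k x * gam m a l x.
  by rewrite -big_split /=; apply: eq_bigr => m _; rewrite mulrDr.
have P1 := partial_christoffel_lowering x i l j k Ux.
have P2 := partial_christoffel_lowering x j l i k Ux.
rewrite D in P1; rewrite D in P2.
have key (a b c d e h r s t : R) : r = a - (d + c) -> s = b - (e + h) ->
    t = d - e -> r - s + t = a - b - c + h by move=> -> -> ->; ring.
exact: key P1 P2 E.
Qed.

Lemma riemann_low_anti12 x i j k l : U x ->
  riemann_low G i j k l x = - riemann_low G j i k l x.
Proof.
move=> Ux; rewrite (riemann_lowE x i j k l Ux) (riemann_lowE x j i k l Ux).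
have key (a b c d : R) : a - b - c + d = - (b - a - d + c) by ring.
exact: key.
Qed.

(** Both sides are g(nabla_j d_k, nabla_i d_l), with one factor or the other lowered. *)
Let quad_sym x i j k l : U x -> \sum_m Gam m j k x * gam m i l x =
  \sum_m Gam m i l x * gam m j k x.
Proof.
move=> Ux; under eq_bigr do rewrite -christoffel_lowering // mulr_sumr.
under [RHS]eq_bigr do rewrite -christoffel_lowering // mulr_sumr.
rewrite exchange_big /=; do 2![apply: eq_bigr => ? _].
by rewrite (G_entry_sym x _ _ Ux); ring.
Qed.

(** Symmetrizing in k and l turns the derivative terms into second derivatives of g_kl, by metric
    compatibility. These cancel because partial derivatives commute, and the quadratic terms cancel
    by [quad_sym]. *)
Lemma riemann_low_anti34 x i j k l : U x ->
  riemann_low G i j k l x = - riemann_low G i j l k x.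
Proof.
move=> Ux; rewrite !riemann_lowE //.
rewrite (quad_sym x i j k l Ux) (quad_sym x j i k l Ux).
have D u v : partial u (gam l v k) x + partial u (gam k v l) x =
    partial u (partial v (fun y => G y k l)) x.
  rewrite /partial -deriveD; try exact: derivable_christoffel_low.
  apply: eq_derive_on => // y Uy.
  exact: esym (metric_compatible y v k l Uy).
have key (a b c d p q r : R) : p + q = r -> a + b = r ->
    p - a - c + d = - (q - b - d + c) by move=> pq ab; lra.
apply: (key _ _ _ _ _ _ _ (D i j)).
by rewrite D; exact: derive_entry_comm.
Qed.

(** Torsion-freeness, that is, symmetry of the Christoffel symbols in their lower indices, makes the
    cyclic sum cancel in pairs. *)
Lemma riemann_low_bianchi x i j k l : U x ->
  riemann_low G i j k l x + riemann_low G j k i l x + riemann_low G k i j l x = 0.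
Proof.
move=> Ux; rewrite !riemann_lowE //.
have S u v w : partial u (gam l v w) x = partial u (gam l w v) x.
  by apply: eq_derive_on => // y; exact: christoffel_low_sym.
rewrite (S i k j) (S j k i) (S k j i).
have Q u v w : \sum_m Gam m u v x * gam m w l x = \sum_m Gam m v u x * gam m w l x.
  by apply: eq_bigr => m _; rewrite christoffel_sym.
rewrite (Q k j i) (Q k i j) (Q j i k).
have key (a b c p q r : R) :
    a - b - p + q + (b - c - q + r) + (c - a - r + p) = 0 by ring.
exact: key.
Qed.

End RiemannSymmetries.

(** * Algebraic curvature tensors *)

Section ScalarMaps.
Context {R : realType} {n : nat}.
Implicit Types (f : 'rV[R]_n -> R) (u v : 'rV[R]_n).

Lemma scalar0 f : scalar f -> f 0 = 0.
Proof. by move=> fl; have := fl (-1) 0 0; rewrite scaler0 addr0 mulN1r addNr. Qed.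

Lemma scalarD f u v : scalar f -> f (u + v) = f u + f v.
Proof. by move=> fl; have := fl 1 u v; rewrite scale1r mul1r. Qed.

Lemma scalarZ f k u : scalar f -> f (k *: u) = k * f u.
Proof. by move=> fl; have := fl k u 0; rewrite addr0 scalar0 ?addr0. Qed.

Lemma scalarBZ f k u v : scalar f -> f (u - k *: v) = f u - k * f v.
Proof.
by move=> fl; rewrite scalarD // -scaleNr scalarZ // mulNr.
Qed.

Lemma scalar_basis f v : scalar f -> f v = \sum_i v 0 i * f (basis_vector i).
Proof.
move=> fl; rewrite {1}[v]row_sum_delta.
elim/big_rec2: _ => [|i y x _ <-]; first exact: scalar0.
exact: fl.
Qed.

End ScalarMaps.

(** * Traces of bilinear forms with respect to the metric *)

Section Trace.
Context {R : realType} {n : nat}.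
Local Notation V := 'rV[R]_n.
Variable g : 'M[R]_n.
Hypotheses (g_sym : g^T = g) (g_unit : g \in unitmx).

Lemma inner_scalar X : scalar (inner g ^~ X).
Proof. by move=> k u v; rewrite /inner !mulmxDl -!scalemxAl !mxE. Qed.

Lemma inner_sym X Y : inner g X Y = inner g Y X.
Proof.
by rewrite /inner -[in LHS](trmxK (X *m g *m Y^T)) mxE !trmx_mul trmxK g_sym mulmxA.
Qed.

Lemma eq_trace2 (A B : tensor2) : A =2 B -> trace2 g A = trace2 g B.
Proof. by move=> AB; do 2![apply: eq_bigr => ? _]; rewrite AB. Qed.

Lemma trace2D (A B : V -> V -> R) :
  trace2 g (fun a b => A a b + B a b) = trace2 g A + trace2 g B.
Proof.
rewrite /trace2 -big_split /=; apply: eq_bigr => i _.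
by rewrite -big_split /=; apply: eq_bigr => j _; rewrite mulrDr.
Qed.

Lemma trace2Z k (A : V -> V -> R) :
  trace2 g (fun a b => k * A a b) = k * trace2 g A.
Proof.
rewrite /trace2 mulr_sumr; apply: eq_bigr => i _.
by rewrite mulr_sumr; apply: eq_bigr => j _; rewrite mulrCA.
Qed.

Lemma invmx_sym i j : invmx g i j = invmx g j i.
Proof. by rewrite -[in LHS]g_sym -trmx_inv mxE. Qed.

Lemma trace2_tr (A : V -> V -> R) :
  trace2 g (fun a b => A b a) = trace2 g A.
Proof.
rewrite /trace2 exchange_big /=; do 2![apply: eq_bigr => ? _].
by rewrite invmx_sym.
Qed.

(** The contraction rule behind the trace computations below: the inverse metric undoes the lowering
    of [X]. *)
Lemma trace2_inner X (l : V -> R) : scalar l ->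
  trace2 g (fun a b => inner g a X * l b) = l X.
Proof.
move=> ll; rewrite (scalar_basis _ X ll) /trace2 exchange_big /=.
apply: eq_bigr => j _.
transitivity ((invmx g *m (g *m X^T)) j 0 * l (basis_vector j)).
  rewrite mxE mulr_suml; apply: eq_bigr => i _.
  by rewrite mulrA /inner -mulmxA -rowE mxE invmx_sym.
by rewrite mulKmx // mxE.
Qed.

Lemma trace2_metric : trace2 g (inner g) = n%:R.
Proof.
rewrite -[RHS](@mxtrace1 R n) -(mulVmx g_unit) /mxtrace.
apply: eq_bigr => i _; rewrite mxE; apply: eq_bigr => j _.
congr (_ * _).
by rewrite /inner -mulmxA -rowE trmx_delta -colE !mxE -[in LHS]g_sym mxE.
Qed.

End Trace.

Section AlgebraicCurvature.
Context {R : realType} {n : nat}.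
Local Notation V := 'rV[R]_n.

(** Linearity is recorded in the first slot only; the symmetries carry it to the other slots. *)
Record algebraic_curvature (D : @tensor4 R n) : Prop := AlgebraicCurvature {
  ac_scalar : forall Y Z W, scalar (fun X => D X Y Z W);
  ac_anti12 : forall X Y Z W, D X Y Z W = - D Y X Z W;
  ac_anti34 : forall X Y Z W, D X Y Z W = - D X Y W Z;
  ac_bianchi : forall X Y Z W, D X Y Z W + D Y Z X W + D Z X Y W = 0
}.

(** The octahedron argument: four instances of the Bianchi identity, normalized by the two
    antisymmetries, combine linearly to the claim. *)
Lemma ac_pair D X Y Z W : algebraic_curvature D -> D X Y Z W = D Z W X Y.
Proof.
move=> [_ a12 a34 b].
have := b X Y Z W; have := b Y Z W X; have := b Z W X Y; have := b W X Y Z.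
rewrite !(a12 Z X) !(a12 W X) !(a12 W Y).
rewrite (a34 X Y W Z) (a34 X Z W Y) (a34 X W Z Y).
rewrite (a34 Y Z W X) (a34 Y W Z X) (a34 Z W Y X).
lra.
Qed.

Lemma ac_scalar2 D X Z W : algebraic_curvature D ->
  scalar (fun Y => D X Y Z W).
Proof.
move=> Dc k u v; rewrite !(ac_anti12 _ Dc X).
by rewrite (ac_scalar _ Dc) opprD mulrN.
Qed.

Lemma ac_scalar3 D X Y W : algebraic_curvature D ->
  scalar (fun Z => D X Y Z W).
Proof.
by move=> Dc k u v; rewrite !(ac_pair _ X Y _ _ Dc) (ac_scalar _ Dc).
Qed.

Variable g : 'M[R]_n.
Hypotheses (g_sym : g^T = g) (g_unit : g \in unitmx).
Local Notation "<< X , Y >>" := (inner g X Y).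

Definition constant_curvature (k : R) : @tensor4 R n := fun X Y Z W =>
  k * (<<X, W>> * <<Y, Z>> - <<X, Z>> * <<Y, W>>).

Lemma ac_sub_constant D k : algebraic_curvature D ->
  algebraic_curvature (fun X Y Z W => D X Y Z W - constant_curvature k X Y Z W).
Proof.
rewrite /constant_curvature => -[l a12 a34 b].
split=> [Y Z W r u v|X Y Z W|X Y Z W|X Y Z W].
- by rewrite l !(inner_scalar g _ r u v) /=; ring.
- by rewrite a12; ring.
- by rewrite a34; ring.
- rewrite (inner_sym _ g_sym Y X) (inner_sym _ g_sym Z X) (inner_sym _ g_sym Z Y).
  by have := b X Y Z W; lra.
Qed.

Lemma ricciE D X Y : ricci g D X Y = trace2 g (fun a b => D a X Y b).
Proof. by []. Qed.

Lemma ricci_sym D X Y : algebraic_curvature D -> ricci g D X Y = ricci g D Y X.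
Proof.
move=> Dc; rewrite !ricciE -[RHS]trace2_tr //.
apply: eq_trace2 => a b.
by rewrite (ac_pair _ _ _ _ _ Dc) (ac_anti12 _ Dc) (ac_anti34 _ Dc) opprK.
Qed.

Lemma ricci_scalar D X : algebraic_curvature D -> scalar (ricci g D X).
Proof.
move=> Dc k u v; rewrite !ricciE -trace2Z -trace2D; apply: eq_trace2 => a b.
by rewrite (ac_scalar3 _ _ _ _ Dc).
Qed.

Lemma inner_scalar2 X : scalar (inner g X).
Proof. by move=> k u v; rewrite !(inner_sym _ g_sym X) inner_scalar. Qed.

Lemma ricci_sub_constant D k X Y : algebraic_curvature D ->
  ricci g (fun X Y Z W => D X Y Z W - constant_curvature k X Y Z W) X Y =
  ricci g D X Y - k * (n%:R - 1) * <<X, Y>>.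
Proof.
move=> Dc; rewrite ricciE.
transitivity (trace2 g (fun a b => D a X Y b +
  (- k * <<X, Y>> * <<a, b>> + k * (<<a, Y>> * <<X, b>>)))).
  by apply: eq_trace2 => a b; rewrite /constant_curvature; ring.
rewrite !trace2D !trace2Z trace2_metric // trace2_inner //; last first.
  exact: inner_scalar2.
by rewrite -ricciE; ring.
Qed.


(** * The hyperplane orthogonal to a possibly null vector *)

Section NullHyperplane.
Variables T U : V.
Hypothesis TU : <<U, T>> = 1.

(** Since [T] may be null, the projection onto its orthogonal hyperplane is taken along a
    transversal vector [U]. *)
Lemma inner_proj X : <<X - <<X, T>> *: U, T>> = 0.
Proof.
by rewrite (scalarBZ (inner g ^~ T) _ _ _ (inner_scalar g T)) TU mulr1 subrr.
Qed.

(** For the Ricci tensor, the last hypothesis is what antisymmetry of the curvature in its last pair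
    leaves on the hyperplane. Tracing it shows that [S] agrees with a multiple of the metric as soon
    as one argument lies in the hyperplane; symmetry then leaves only a multiple of the square of
    [<<_, T>>]. *)
Lemma bilinear_proportional (S : V -> V -> R) :
    (3 <= n)%N -> (forall X Y, S X Y = S Y X) -> (forall X, scalar (S X)) ->
    (forall X Y Z W, <<X, T>> = 0 -> <<Y, T>> = 0 ->
      S Y Z * <<X, W>> - S X Z * <<Y, W>> +
      S Y W * <<X, Z>> - S X W * <<Y, Z>> = 0) ->
  exists lam mu, forall X Y, S X Y = lam * <<X, Y>> + mu * <<X, T>> * <<Y, T>>.
Proof.
move=> n3 Ss Sl2 H.
have Sl X : scalar (S ^~ X) by move=> k u v; rewrite !(Ss _ X) Sl2.
have il2 X : scalar (inner g X) by exact: inner_scalar2.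
have n_neq1 : n%:R - 1 != 0 :> R.
  by rewrite subr_eq0 pnatr_eq1; case: n n3 => [|[|?]].
have n_neq2 : n%:R - 2 != 0 :> R.
  by rewrite subr_eq0 eqr_nat; case: n n3 => [|[|[|?]]].
have E X Z : <<X, T>> = 0 -> (n%:R - 1) * S X Z =
    (trace2 g S - S U T) * <<X, Z>> + S X T * <<U, Z>>.
  move=> XT.
  (* The hypothesis at [Y = a - <<a, T>> *: U], [W = b], to be traced over [a], [b]. *)
  have F a b : <<b, X>> * S a Z + (- 1 * (<<a, Z>> * S X b) +
      (<<X, Z>> * S a b + (- S X Z * <<a, b>> +
      (- S U Z * (<<a, T>> * <<X, b>>) + (S X Z * (<<a, T>> * <<U, b>>) +
      (- <<X, Z>> * (<<a, T>> * S U b) +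
       <<U, Z>> * (<<a, T>> * S X b))))))) = 0.
    rewrite -[RHS](H X _ Z b XT (inner_proj a)) (scalarBZ _ _ _ _ (Sl Z)).
    rewrite (scalarBZ _ _ _ _ (Sl b)) (scalarBZ _ _ _ _ (inner_scalar g b)).
    rewrite (scalarBZ _ _ _ _ (inner_scalar g Z)) (inner_sym _ g_sym b X).
    by ring.
  have : trace2 g (fun _ _ => 0) = 0.
    by rewrite /trace2 big1 // => i _; rewrite big1 // => j _; rewrite mulr0.
  rewrite -(eq_trace2 _ _ _ F) !trace2D !trace2Z.
  rewrite (trace2_tr _ g_sym (fun a b => <<a, X>> * S b Z)) !trace2_inner //.
  by rewrite trace2_metric // XT TU => {}H; lra.
pose lam := (trace2 g S - S U T) / (n%:R - 1).
(* At [Z = T], [E] reads [(n%:R - 1) * S X T = S X T]; here the dimension must differ from 2. *)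
have SXT X : <<X, T>> = 0 -> S X T = 0.
  move=> XT; apply: (mulfI n_neq2); have := E X T XT.
  by rewrite XT TU; lra.
have E0 X Z : <<X, T>> = 0 -> S X Z = lam * <<X, Z>>.
  move=> XT; apply: (mulfI n_neq1); rewrite E // (SXT X XT) /lam.
  by field.
(* The defect of [S = lam g] along [U]. It vanishes on the hyperplane, so it equals [tau U] times
   [<<_, T>>], which gives [mu]. *)
pose tau Z := S U Z - lam * <<U, Z>>.
have tau0 Z : <<Z, T>> = 0 -> tau Z = 0.
  by move=> ZT; rewrite /tau Ss E0 // (inner_sym _ g_sym U) subrr.
have taul : scalar tau.
  by move=> k u v; rewrite /tau Sl2 il2 /=; ring.
exists lam, (tau U) => X Z.
have := E0 _ Z (inner_proj X); have := tau0 _ (inner_proj Z).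
rewrite (scalarBZ _ _ _ _ taul) (scalarBZ _ _ _ _ (Sl Z)).
rewrite (scalarBZ _ _ _ _ (inner_scalar g Z)) => /eqP; rewrite subr_eq0 => /eqP.
rewrite {1}/tau => h1 h2.
have -> : S X Z = lam * <<X, Z>> + <<X, T>> * (S U Z - lam * <<U, Z>>) by lra.
by rewrite h1; ring.
Qed.

(** * Curvature tensors vanishing on the hyperplane, with Ricci tensor of rank at most one *)

Section RankOneRicci.
Variables (W : @tensor4 R n) (mu : R).
Hypothesis W_ac : algebraic_curvature W.
Hypothesis W_kernel : forall X Y Z V,
  <<X, T>> = 0 -> <<Y, T>> = 0 -> W X Y Z V = 0.
Hypothesis W_ricci : forall X Y, ricci g W X Y = mu * <<X, T>> * <<Y, T>>.

Local Notation B := (fun Y Z => W U Y Z U).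

Let WUU X Y : W U U X Y = 0.
Proof. by have := ac_anti12 _ W_ac U U X Y; lra. Qed.

Let B_sym X Y : W U X Y U = W U Y X U.
Proof.
by rewrite (ac_pair _ _ _ _ _ W_ac) (ac_anti12 _ W_ac) (ac_anti34 _ W_ac) opprK.
Qed.

(** [W] vanishes at the projections of [X] and [Y]; expanding them leaves only terms with [U] in the
    first pair. *)
Let expand12 X Y Z V :
  W X Y Z V = <<X, T>> * W U Y Z V - <<Y, T>> * W U X Z V.
Proof.
have := W_kernel _ _ Z V (inner_proj X) (inner_proj Y).
rewrite (scalarBZ _ _ _ _ (ac_scalar _ W_ac _ Z V)).
rewrite !(scalarBZ _ _ _ _ (ac_scalar2 _ _ Z V W_ac)) WUU.
by rewrite (ac_anti12 _ W_ac X U); lra.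
Qed.

(** Pair symmetry allows [expand12] to be used on both pairs. *)
Lemma kernel_normal_form X Y Z V : W X Y Z V =
  <<X, T>> * <<V, T>> * B Y Z + <<Y, T>> * <<Z, T>> * B X V
  - <<X, T>> * <<Z, T>> * B Y V - <<Y, T>> * <<V, T>> * B X Z.
Proof.
rewrite expand12 (ac_pair _ U Y _ _ W_ac) (ac_pair _ U X _ _ W_ac).
rewrite (expand12 Z V U Y) (expand12 Z V U X).
rewrite (ac_anti34 _ W_ac U V U Y) (ac_anti34 _ W_ac U Z U Y).
rewrite (ac_anti34 _ W_ac U V U X) (ac_anti34 _ W_ac U Z U X).
rewrite (B_sym V Y) (B_sym V X) (B_sym Z Y) (B_sym Z X).
by ring.
Qed.

(** The normal form is traced over its first and last slots and compared with [W_ricci]. Evaluating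
    at (U, U), (Y, U) and (Y, Z), in this order, gives [B_trace], [B_T] and [B_norm]. *)
Lemma kernel_trace Y Z : <<T, T>> * B Y Z + trace2 g B * <<Y, T>> * <<Z, T>>
  - <<Z, T>> * B Y T - <<Y, T>> * B T Z = mu * <<Y, T>> * <<Z, T>>.
Proof.
rewrite -W_ricci ricciE.
rewrite [RHS](eq_trace2 _ _ (fun a b => B Y Z * (<<a, T>> * <<b, T>>) +
  (<<Y, T>> * <<Z, T>> * B a b + (- <<Z, T>> * (<<a, T>> * B Y b) +
   - <<Y, T>> * (<<b, T>> * B a Z))))); last first.
  by move=> a b; rewrite (kernel_normal_form a); ring.
rewrite !trace2D !trace2Z (trace2_tr _ g_sym (fun a b => <<a, T>> * B b Z)).
rewrite !trace2_inner //; first by ring.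
all: by [exact: inner_scalar | exact: ac_scalar2 | exact: ac_scalar3].
Qed.

Let B_U Y : W U Y U U = 0.
Proof. by have := ac_anti34 _ W_ac U Y U U; lra. Qed.

Let B_trace : trace2 g B = mu.
Proof.
have := kernel_trace U U; rewrite !B_U TU WUU; lra.
Qed.

Let B_T Y : W U Y T U = 0.
Proof.
by have := kernel_trace Y U; rewrite B_trace TU !B_U; lra.
Qed.

Let B_norm Y Z : <<T, T>> * W U Y Z U = 0.
Proof.
by have := kernel_trace Y Z; rewrite B_trace (B_sym T Z) !B_T; lra.
Qed.

Lemma norm_or_ricci0 : mu * <<T, T>> = 0.
Proof.
rewrite -B_trace mulrC -trace2Z.
by rewrite /trace2 big1 // => i _; rewrite big1 // => j _; rewrite B_norm mulr0.
Qed.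

Let WT X Y Z : W T X Y Z = 0.
Proof.
rewrite kernel_normal_form (B_sym T) B_T (B_sym T) B_T.
transitivity (<<Z, T>> * (<<T, T>> * B X Y) - <<Y, T>> * (<<T, T>> * B X Z)).
  by ring.
by rewrite !B_norm !mulr0 subrr.
Qed.

(** The [T] component of [E X Y Z] is killed by [WT], so each term of the action is [<<_, T>>] times
    a value of [W] at [c]. As [c] lies in the hyperplane, the normal form of that value keeps only
    two terms, and the four contributions cancel. *)
Lemma act_null (E : V -> V -> V -> V) X Y al c :
    (forall Z, E X Y Z = al Z *: T + <<Z, T>> *: c) -> <<c, T>> = 0 ->
  forall X1 X2 X3 X4, act E W X1 X2 X3 X4 X Y = 0.
Proof.
move=> EE cT X1 X2 X3 X4.
have E1 Z Y1 Y2 Y3 : W (E X Y Z) Y1 Y2 Y3 = <<Z, T>> * W c Y1 Y2 Y3.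
  rewrite EE (ac_scalar _ W_ac) WT mulr0 add0r.
  by rewrite (scalarZ _ _ _ (ac_scalar _ W_ac _ _ _)).
rewrite /act (ac_anti12 _ W_ac X1) (ac_pair _ X1 X2 _ _ W_ac).
rewrite (ac_pair _ X1 X2 X3 _ W_ac) (ac_anti12 _ W_ac X3 (E _ _ _)) !E1.
rewrite 4!(kernel_normal_form c) cT.
by ring.
Qed.

Lemma dot_null X1 X2 X3 X4 X Y : dot g W W X1 X2 X3 X4 X Y = 0.
Proof.
(* [b] is the endomorphism with [<<b Z, V>> = B Z V]. The coefficients of [T] and [<<Z, T>>] are
   read off the normal form. *)
pose b Z := (\row_j W U Z (basis_vector j) U) *m invmx g.
apply: (act_null _ _ _ (fun Z => <<X, T>> * B Y Z - <<Y, T>> * B X Z)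
  (<<Y, T>> *: b X - <<X, T>> *: b Y)).
  have Tg j : (T *m g) 0 j = <<basis_vector j, T>>.
    by rewrite /inner -mulmxA -rowE [RHS]mxE -[g in RHS]g_sym -trmx_mul [RHS]mxE.
  (* Writing [T] as [T *m g *m invmx g] lets the factor [invmx g] be taken out, so that covectors
     are compared. *)
  move=> Z; rewrite -[X in _ = _ *: X + _](mulmxK g_unit) /raise /b.
  move: (T *m g) Tg => v vE.
  rewrite !scalemxAl -mulmxBl !scalemxAl -mulmxDl; congr (_ *m _).
  apply/rowP => j; rewrite !mxE vE (kernel_normal_form X Y Z).
  by ring.
rewrite (scalarBZ _ _ _ _ (inner_scalar g T)) (scalarZ _ _ _ (inner_scalar g T)).
have bT Z : <<b Z, T>> = 0.
  rewrite (@inner_raise _ _ g (fun _ _ Z V => W U Z V U) 0 0) ?B_T // => V.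
  exact: scalar_basis (ac_scalar3 _ _ _ _ W_ac).
by rewrite !bT !mulr0 subrr.
Qed.

(** The wedge has no separate [T] term here, and its [c] is orthogonal to [T] because the two
    products of [<<X, T>>] and [<<Y, T>>] cancel. *)
Lemma tachibana_null X1 X2 X3 X4 X Y :
  tachibana (fun Z Z' => mu * <<Z, T>> * <<Z', T>>) W X1 X2 X3 X4 X Y = 0.
Proof.
apply: (act_null _ _ _ (fun=> 0)
  ((mu * <<Y, T>>) *: X - (mu * <<X, T>>) *: Y)).
  move=> Z; rewrite scale0r add0r /wedge scalerBr !scalerA.
  by congr (_ *: _ - _ *: _); ring.
rewrite (scalarBZ _ _ _ _ (inner_scalar g T)) (scalarZ _ _ _ (inner_scalar g T)).
by ring.
Qed.

End RankOneRicci.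

End NullHyperplane.
End AlgebraicCurvature.

(** * The identity on a single tangent space *)

Section Venzi.
Context {R : realType} {n : nat}.
Local Notation V := 'rV[R]_n.
Variable g : 'M[R]_n.
Hypotheses (g_sym : g^T = g) (g_unit : g \in unitmx).
Local Notation "<< X , Y >>" := (inner g X Y).

Lemma pairing_inner theta (u : V) : pairing theta u = <<u, theta *m invmx g>>.
Proof.
rewrite /inner trmx_mul trmx_inv g_sym mulmxA mulmxK // mxE.
by apply: eq_bigr => j _; rewrite mxE.
Qed.

Lemma pairing_eq1 (theta : V) : theta != 0 -> exists u, pairing theta u = 1.
Proof.
move=> /eqP t0; have [i ti] : exists i, theta 0 i != 0.
  apply: contrapT => /forallNP nt; apply: t0; apply/rowP => i; rewrite mxE.
  by apply/eqP; have /negP := nt i; rewrite negbK.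
exists ((theta 0 i)^-1 *: basis_vector i).
rewrite /pairing (bigD1 i) //= big1 ?addr0 => [|j ji].
  by rewrite !mxE !eqxx mulr1 mulVf.
by rewrite !mxE (negbTE ji) andbF mulr0 mul0r.
Qed.

Lemma projective_venzi_identity (D : tensor4) (theta : V) :
    (3 <= n)%N -> algebraic_curvature D -> theta != 0 ->
    (forall X1 X2 X3 X4 X5,
      pairing theta X1 * projective g D X2 X3 X4 X5 +
      pairing theta X2 * projective g D X3 X1 X4 X5 +
      pairing theta X3 * projective g D X1 X2 X4 X5 = 0) ->
  forall X1 X2 X3 X4 X Y,
  dot g (concircular g D) (concircular g D) X1 X2 X3 X4 X Y =
  tachibana (fun U W => ricci g D U W - scalar_curvature g D / n%:R * <<U, W>>)
    (concircular g D) X1 X2 X3 X4 X Y.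
Proof.
move=> n3 Dc theta0 Dvenzi X1 X2 X3 X4 X Y.
have [U TU] := pairing_eq1 _ theta0.
move: TU Dvenzi; rewrite pairing_inner; set T := _ *m _ => TU.
have n_neq0 : n%:R != 0 :> R by rewrite pnatr_eq0; case: n n3.
have n_neq1 : n%:R - 1 != 0 :> R.
  by rewrite subr_eq0 pnatr_eq1; case: n n3 => [|[|?]].
(* Put [U] in the first slot of the Venzi condition: for [A], [B] in the kernel of theta only the
   projective tensor at [A], [B] survives. *)
move=> Dvenzi; have P0 A B C E : <<A, T>> = 0 -> <<B, T>> = 0 -> D A B C E =
    (n%:R - 1)^-1 * (ricci g D B C * <<A, E>> - ricci g D A C * <<B, E>>).
  move=> AT BT; have := Dvenzi U A B C E; rewrite !pairing_inner -/T TU AT BT.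
  by rewrite !mul0r !addr0 mul1r => /subr0_eq.
have [A B C E AT BT|lam [mu Ric]] := bilinear_proportional g g_sym g_unit T U TU
  (ricci g D) n3 (fun A B => ricci_sym g g_sym D A B Dc)
  (fun A => ricci_scalar g D A Dc).
  apply: (mulfI (invr_neq0 n_neq1)); rewrite mulr0.
  have := P0 A B C E AT BT; have := P0 A B E C AT BT.
  by rewrite (ac_anti34 _ Dc A B E C); lra.
(* Constant curvature [k] has Ricci tensor [lam] g, so subtracting it leaves only the [mu] term. *)
pose k := lam / (n%:R - 1).
pose W X Y Z V := D X Y Z V - constant_curvature g k X Y Z V.
have Wc : algebraic_curvature W by exact: ac_sub_constant.
have WT A B C E : <<A, T>> = 0 -> <<B, T>> = 0 -> W A B C E = 0.
  move=> AT BT; rewrite /W (P0 _ _ C E AT BT) /constant_curvature !Ric AT BT /k.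
  by field.
have Wr A B : ricci g W A B = mu * <<A, T>> * <<B, T>>.
  by rewrite ricci_sub_constant // Ric /k divfK // addrC addKr.
have muT : mu * <<T, T>> = 0 by apply: norm_or_ricci0 TU _ _ Wc WT Wr.
(* The trace of the [mu] term is [mu * <<T, T>>], which is 0. Hence [k] is the concircular
   coefficient and [W] the concircular tensor. *)
have kap : scalar_curvature g D = n%:R * lam.
  rewrite /scalar_curvature (eq_trace2 _ _ (fun a b => lam * <<a, b>> +
    mu * (<<a, T>> * <<b, T>>))); last by move=> a b; rewrite Ric mulrA.
  rewrite trace2D !trace2Z trace2_metric // trace2_inner //; last first.
    exact: inner_scalar.
  by rewrite muT addr0 mulrC.
have WE : concircular g D = W.
  do 4![apply/funext => ?]; rewrite /concircular /W /constant_curvature kap /k.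
  by congr (_ - _ * _); field; rewrite ?n_neq0 ?n_neq1.
rewrite WE (dot_null g g_sym g_unit T U TU W mu Wc WT Wr).
have -> : (fun A B => ricci g D A B - scalar_curvature g D / n%:R * <<A, B>>) =
    (fun A B => mu * <<A, T>> * <<B, T>>).
  apply/funext => A; apply/funext => B.
  by rewrite Ric kap (mulrC n%:R) mulfK // addrC addKr.
by rewrite (tachibana_null g g_sym g_unit T U TU W mu Wc WT Wr).
Qed.

End Venzi.

(** * From components in a chart to tensors *)

Section Components.
Context {R : realType} {n : nat}.
Implicit Types F : 'I_n -> 'I_n -> 'I_n -> 'I_n -> R.

Local Notation sum4 F := (\sum_i \sum_j \sum_k \sum_l F i j k l).

Let eq_sum4 F F' : (forall i j k l, F i j k l = F' i j k l) -> sum4 F = sum4 F'.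
Proof. by move=> E; do 4![apply: eq_bigr => ? _]; exact: E. Qed.

Let sum4N F : sum4 (fun i j k l => - F i j k l) = - sum4 F.
Proof. by do 4![rewrite -sumrN; apply: eq_bigr => ? _]. Qed.

Let sum4D F F' : sum4 (fun i j k l => F i j k l + F' i j k l) = sum4 F + sum4 F'.
Proof. by do 4![rewrite -big_split; apply: eq_bigr => ? _]. Qed.

Let sum4Z a F : sum4 (fun i j k l => a * F i j k l) = a * sum4 F.
Proof. by do 4![rewrite mulr_sumr; apply: eq_bigr => ? _]. Qed.

Let sum4_swap12 F : sum4 F = sum4 (fun i j k l => F j i k l).
Proof. by rewrite exchange_big. Qed.

Let sum4_swap23 F : sum4 F = sum4 (fun i j k l => F i k j l).
Proof. by apply: eq_bigr => i _; rewrite exchange_big. Qed.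

Let sum4_swap34 F : sum4 F = sum4 (fun i j k l => F i j l k).
Proof. by do 2![apply: eq_bigr => ? _]; rewrite exchange_big. Qed.

Lemma components_algebraic_curvature (r : 'I_n -> 'I_n -> 'I_n -> 'I_n -> R) :
  (forall i j k l, r i j k l = - r j i k l) ->
  (forall i j k l, r i j k l = - r i j l k) ->
  (forall i j k l, r i j k l + r j k i l + r k i j l = 0) ->
  algebraic_curvature (fun X1 X2 X3 X4 : 'rV[R]_n =>
    sum4 (fun i j k l => X1 0 i * X2 0 j * X3 0 k * X4 0 l * r i j k l)).
Proof.
move=> r12 r34 rb; split=> [Y Z W a u v|X Y Z W|X Y Z W|X Y Z W].
- rewrite /= -sum4Z -sum4D; apply: eq_sum4 => i j k l.
  by rewrite !mxE; ring.
- rewrite [in RHS]sum4_swap12 -sum4N; apply: eq_sum4 => i j k l.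
  by rewrite [in LHS]r12; ring.
- rewrite [in RHS]sum4_swap34 -sum4N; apply: eq_sum4 => i j k l.
  by rewrite [in LHS]r34; ring.
(* Reindexing gives all three cyclic sums the same coefficient, so that [rb] applies termwise. *)
- rewrite [X in _ + X + _]sum4_swap23 [X in _ + X + _]sum4_swap12.
  rewrite [X in _ + _ + X]sum4_swap12 [X in _ + _ + X]sum4_swap23 -!sum4D.
  rewrite -[RHS](mul0r (sum4 r)) -sum4Z; apply: eq_sum4 => i j k l.
  rewrite mul0r -[RHS](mulr0 (X 0 i * Y 0 j * Z 0 k * W 0 l)) -(rb i j k l).
  by ring.
Qed.

End Components.

Lemma riemann_algebraic_curvature (R : realType) (n : nat) (M : manifold R n)
    (g : metric M) (c : chart R n M) (p : M) : atlas c -> cdom c p ->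
  algebraic_curvature (riemann g c p).
Proof.
move=> ac cp; have img : cimg c (cmap c p) by exists p.
have gs : forall x, cimg c x ->
    ((metric_mx g c \o cinv c) x)^T = (metric_mx g c \o cinv c) x.
  by move=> _ [q cq <-] /=; rewrite cmapK // Defs.metric_sym.
have gu : forall x, cimg c x -> (metric_mx g c \o cinv c) x \in unitmx.
  by move=> _ [q cq <-] /=; rewrite cmapK // metric_nondegenerate.
have gsm := metric_smooth g ac.
apply: (components_algebraic_curvature (fun i j k l =>
  riemann_low (metric_mx g c \o cinv c) i j k l (cmap c p))) => i j k l.
- exact: (riemann_low_anti12 _ _ (@cimg_open _ _ _ c) gsm gs gu _ _ _ _ _ img).
- exact: (riemann_low_anti34 _ _ (@cimg_open _ _ _ c) gsm gs gu _ _ _ _ _ img).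
- exact: (riemann_low_bianchi _ _ (@cimg_open _ _ _ c) gsm gs gu _ _ _ _ _ img).
Qed.

(** [venzi_space] provides a nonzero form in some chart at the point, whereas the identity is
    claimed in every chart. *)
Lemma form_rv_neq0 (R : realType) (n : nat) (M : manifold R n)
    (Theta : one_form M) (c c' : chart R n M) (p : M) :
  atlas c -> atlas c' -> cdom c p -> cdom c' p ->
  form_rv Theta c' p != 0 -> form_rv Theta c p != 0.
Proof.
move=> ac ac' cp cp'; apply: contra_neq => c0.
by rewrite (form_change Theta ac' ac cp' cp) c0 mul0mx.
Qed.

Theorem theorem4p4 (R : realType) (n : nat) (n_ge3 : (3 <= n)%N)
    (M : manifold R n) (M_connected : connected [set: M]) (g : metric M)
    (M_venzi : venzi_space (projective_tensor g)) :
  forall (c : chart R n M) (p : M), atlas c -> cdom c p ->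
  forall X1 X2 X3 X4 X Y : 'rV[R]_n,
    let gp := metric_mx g c p in
    let W := concircular_tensor g c p in
    dot gp W W X1 X2 X3 X4 X Y =
    tachibana
      (fun U V => ricci_tensor g c p U V - kappa g c p / n%:R * inner gp U V)
      W X1 X2 X3 X4 X Y.
Proof.
move=> c p ac cp X1 X2 X3 X4 X Y gp W.
(* The identity is pointwise, so a Venzi form that is nonzero at [p] suffices. *)
have [theta theta_venzi [c' [ac' cp' theta0]]] := M_venzi p.
apply: (projective_venzi_identity gp _ _ (riemann g c p) (form_rv theta c p)) => //.
- exact: Defs.metric_sym.
- exact: metric_nondegenerate.
- exact: riemann_algebraic_curvature.
- exact: form_rv_neq0 theta0.
- exact: theta_venzi.
Qed.
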